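(* Let $M$ be a left $R$-module which is a self-progenerator in $\sigma[M]$. Assume $M$ is a Gelfand module and $Max(M)$ is compact. Then $\Psi(M)\cong SPm(M)$ as frames.
   Context: $R$ is an associative ring with identity; modules are unital left $R$-modules. A submodule $N\leq M$ is fully invariant if $f(N)\subseteq N$ for all $f\in\mathrm{End}_R(M)$; $\Lambda^{fi}(M)$ is the lattice of fully invariant submodules of $M$ ordered by inclusion. $Max(M)$ is the set of maximal submodules of $M$, with the topology whose closed sets are $\{\mathcal{M}\in Max(M)\mid N\leq\mathcal{M}\}$, $N\in\Lambda^{fi}(M)$. $\sigma[M]$ is the full subcategory of $R$-Mod of all modules that embed in a quotient of some direct sum $M^{(X)}$. $M$ is $N$-projective if for every epimorphism $\rho\colon N\to X$ and every homomorphism $\alpha\colon M\to X$ there is $\beta\colon M\to N$ with $\rho\beta=\alpha$; $M$ is projective in $\sigma[M]$ if it is $N$-projective for every $N\in\sigma[M]$. $M$ is a self-progenerator in $\sigma[M]$ if it is projective in $\sigma[M]$ and every submodule of $M$ is $M$-generated (a quotient of some $M^{(X)}$). For $N,L\leq M$ put $N_ML=\sum\{f(N)\mid f\in\mathrm{Hom}_R(M,L)\}$. For a module $K$ put $\mathrm{Ann}_M(K)=\bigcap\{\ker f\mid f\in\mathrm{Hom}_R(M,K)\}$. $M$ is Gelfand if for every two distinct $N,L\in Max(M)$ there exist $N',L'\in\Lambda^{fi}(M)$ with $L'\nleq L$, $N'\nleq N$ and $L'_MN'=0$. $\Psi(M)=\{N\in\Lambda^{fi}(M)\mid N+\mathrm{Ann}_M(Rn)=M\text{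 for all }n\in N\}$, ordered by inclusion; it is a frame with joins given by sums and finite meets by intersections. A proper fully invariant submodule $N$ of $M$ is primitive if $N=\mathrm{Ann}_M(S)$ for some simple module $S$ in $\sigma[M]$; a submodule is semiprimitive if it is an intersection of primitive submodules. $SPm(M)=\{M\}\cup\{\text{semiprimitive submodules of }M\}$, ordered by inclusion; it is a frame in which the meet is intersection. *)

(* Defs.v *)
From HB Require Import structures.
From mathcomp Require Import all_boot all_order all_algebra ring_quotient.
From mathcomp Require Import all_classical topology.

Set Implicit Arguments.
Unset Strict Implicit.
Unset Printing Implicit Defensive.
Import Order.TTheory GRing.Theory.
Local Open Scope classical_set_scope.
Local Open Scope quotient_scope.
Local Open Scope ring_scope.

HB.instance Definition _ d (T : porderType d) (A : set T) :=
  SubChoice.on (set_type A).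
HB.instance Definition _ d (T : porderType d) (A : set T) :=
  [SubChoice_isSubPOrder of set_type A by <: with d].

Section Frames.
Local Open Scope order_scope.

(* The first condition also provides all meets, since the meet of A is the
   join of the lower bounds of A; in particular binary meets and a top. *)
Definition is_frame d (L : porderType d) : Prop :=
  (forall A : set L, exists j, supremums A j) /\
  (forall (a : L) (A : set L) (j m : L),
     supremums A j -> infimums [set a; j] m ->
     supremums [set x | exists2 b, A b & infimums [set a; b] x] m).

(* Taking A := set0 in the clause on finite meets gives the preservation
   of the top element. *)
Definition frame_morphism d d' (L : porderType d) (L' : porderType d')
    (f : L -> L') : Prop :=
  (forall (A : set L) j, supremums A j -> supremums (f @` A) (f j)) /\
  (forall (A : set L) m, finite_set A ->
     infimums A m -> infimums (f @` A) (f m)).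

Definition frame_isomorphic d d' (L : porderType d) (L' : porderType d') :
    Prop :=
  [/\ is_frame L, is_frame L' &
   exists (f : L -> L') (g : L' -> L),
     [/\ frame_morphism f, frame_morphism g, cancel f g & cancel g f]].
End Frames.

Section Submodules.
Variables (R : pzRingType) (M : lmodType R).

Record submod := Submod {
  submod_set :> set M;
  submod_subproof : `[< submod_closed [in submod_set] >] }.

HB.instance Definition _ := [isSub for submod_set].
HB.instance Definition _ := [Choice of submod by <:].
HB.instance Definition _ :=
  [SubChoice_isSubPOrder of submod by <: with set_display].

Definition submod_mem (N : submod) : {pred M} := [in (N : set M)].

Lemma submodP (N : submod) : submod_closed (submod_mem N).
Proof. exact/asboolP/submod_subproof. Qed.

HB.instance Definition _ (N : submod) :=
  GRing.isSubmodClosed.Build R M (submod_mem N) (submodP N).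

Definition submod_type (N : submod) : Type := {x : M | x \in submod_mem N}.
HB.instance Definition _ (N : submod) := SubChoice.on (submod_type N).
HB.instance Definition _ (N : submod) :=
  [SubChoice_isSubLmodule of submod_type N by <:].

Lemma cyclic_closed (n : M) :
  `[< submod_closed [in range (fun a : R => a *: n)] >].
Proof.
apply/asboolP; split; first by apply/mem_set; exists 0; rewrite // scale0r.
move=> a u v /set_mem[b _ <-] /set_mem[c _ <-]; apply/mem_set.
by exists (a * b + c); rewrite // scalerDl scalerA.
Qed.

Definition cyclic (n : M) : submod := Submod (cyclic_closed n).

End Submodules.

Section DirectSum.
Variables (X : Type) (R : pzRingType) (M : lmodType R).

Definition finsupp_pred : {pred X -> M} :=
  [pred f : X -> M | `[< finite_set [set x | f x <> 0] >]].

Lemma finsupp_pred_closed : submod_closed finsupp_pred.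
Proof.
split.
  by apply/asboolP; rewrite (_ : mkset _ = set0) // -subset0 => x; exact.
move=> a u v /asboolP fu /asboolP fv; apply/asboolP.
apply: (@sub_finite_set _ _ ([set x | u x <> 0] `|` [set x | v x <> 0])).
  move=> x /= auv; have [u0|] := pselect (u x = 0); last by left.
  right=> v0; apply: auv.
  by rewrite [LHS]/GRing.add /= /GRing.scale /= u0 v0 scaler0 addr0.
by rewrite finite_setU.
Qed.

HB.instance Definition _ := GRing.isSubmodClosed.Build R (X -> M)
  finsupp_pred finsupp_pred_closed.

(* The direct sum $M^{(X)}$. *)
Definition dsum : Type := {f : X -> M | f \in finsupp_pred}.
HB.instance Definition _ := SubChoice.on dsum.
HB.instance Definition _ := [SubChoice_isSubLmodule of dsum by <:].

End DirectSum.

Section Sigma.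
Variables (R : pzRingType) (M : lmodType R).

(* K embeds in a quotient Q of some M^(X). *)
Definition in_sigma (K : lmodType R) : Prop :=
  exists (X : Type) (Q : lmodType R)
         (p : {linear dsum X M -> Q}) (i : {linear K -> Q}),
    range p = setT /\ injective i.

Definition relative_projective (N : lmodType R) : Prop :=
  forall (X : lmodType R) (rho : {linear N -> X}) (alpha : {linear M -> X}),
    range rho = setT ->
    exists beta : {linear M -> N}, forall x, rho (beta x) = alpha x.

Definition projective_in_sigma : Prop :=
  forall N : lmodType R, in_sigma N -> relative_projective N.

Definition generated (K : lmodType R) : Prop :=
  exists (X : Type) (p : {linear dsum X M -> K}), range p = setT.

Definition self_progenerator : Prop :=
  projective_in_sigma /\ forall N : submod M, generated (submod_type N).

Definition simple_module (S : lmodType R) : Prop :=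
  (exists x : S, x <> 0) /\
  (forall K : submod S, K = [set 0] :> set S \/ K = setT :> set S).

Definition fully_invariant (N : submod M) : Prop :=
  forall f : {linear M -> M}, f @` N `<=` N.

Definition Lfi : set (submod M) := [set N : submod M | fully_invariant N].

Definition Max : set (submod M) :=
  [set N : submod M | N <> setT :> set M /\
     forall K : submod M, N `<=` K -> K = N \/ K = setT :> set M].

Definition sum_family (F : set (set M)) : set M :=
  [set x | exists2 s : seq M, (forall y, y \in s -> exists2 A, F A & A y)
                            & x = \sum_(y <- s) y].

(* $N_M L$ *)
Definition prodM (N L : submod M) : set M :=
  sum_family [set val @` (f @` N) | f in [set: {linear M -> submod_type L}]].

Definition annM (K : lmodType R) : set M :=
  \bigcap_(f in [set: {linear M -> K}]) f @^-1` [set 0].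

Definition gelfand : Prop :=
  forall N L : submod M, Max N -> Max L -> N <> L ->
    exists N' L' : submod M,
      [/\ Lfi N', Lfi L', ~ (L' `<=` L), ~ (N' `<=` N)
        & prodM L' N' = [set 0]].

Definition Psi : set (submod M) :=
  [set N : submod M | Lfi N /\
     forall n, (N : set M) n ->
       [set x + y | x in N & y in annM (submod_type (cyclic n))] = setT].

Definition primitive : set (submod M) :=
  [set N : submod M | [/\ Lfi N, N <> setT :> set M &
     exists S : lmodType R,
       [/\ simple_module S, in_sigma S & N = annM S :> set M]]].

Definition semiprimitive : set (submod M) :=
  [set N : submod M | exists2 F : set (submod M), F `<=` primitive
         & N = \bigcap_(P in F) P :> set M].

Definition SPm : set (submod M) :=
  [set N : submod M | N = setT :> set M] `|` semiprimitive.

End Sigma.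

Arguments Lfi {R} M.
Arguments Max {R} M.
Arguments Psi {R} M.
Arguments primitive {R} M.
Arguments semiprimitive {R} M.
Arguments SPm {R} M.
Arguments annM {R} M K.

Section Quotient.
Variables (R : pzRingType) (M : lmodType R) (N : submod M).

Fact oppr_closed_submod : oppr_closed (submod_mem N).
Proof. by move=> x Nx; rewrite -scaleN1r rpredZ. Qed.
HB.instance Definition _ := GRing.isOppClosed.Build M (submod_mem N) oppr_closed_submod.
Definition quot_mod : Type := Quotient.quot (submod_mem N).
HB.instance Definition _ := GRing.Zmodule.on quot_mod.
Definition quot_pi (x : M) : quot_mod := \pi_(Quotient.quot (submod_mem N)) x.
Definition quot_repr (x : quot_mod) : M := repr (x : Quotient.quot (submod_mem N)).
Lemma quot_reprK x : quot_pi (quot_repr x) = x. Proof. exact: reprK. Qed.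
Lemma quot_piE x y : quot_pi x = quot_pi y <-> x - y \in submod_mem N.
Proof. by split=> [/eqP|xy]; last apply/eqP; rewrite /quot_pi ?Quotient.idealrBE // -Quotient.idealrBE. Qed.
Lemma quot_piD x y : quot_pi (x + y) = quot_pi x + quot_pi y.
Proof. exact: Quotient.pi_add. Qed.
Definition quot_scale (a : R) (x : quot_mod) : quot_mod := quot_pi (a *: quot_repr x).
Lemma quot_piZ a x : quot_pi (a *: x) = quot_scale a (quot_pi x).
Proof.
by apply/quot_piE; rewrite -scalerBr rpredZ //; apply/quot_piE; rewrite quot_reprK.
Qed.
Lemma quot_scaleA a b v : quot_scale a (quot_scale b v) = quot_scale (a * b) v.
Proof. by rewrite -(quot_reprK v) -!quot_piZ scalerA. Qed.
Lemma quot_scale1 : left_id 1 quot_scale.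
Proof. by move=> v; rewrite -(quot_reprK v) -!quot_piZ scale1r. Qed.
Lemma quot_scaleDr : right_distributive quot_scale +%R.
Proof. by move=> a u v; rewrite -(quot_reprK v) -(quot_reprK u) -quot_piD -!quot_piZ -quot_piD scalerDr. Qed.
Lemma quot_scaleDl v : {morph quot_scale^~ v : a b / a + b}.
Proof. by move=> a b; rewrite -(quot_reprK v) -!quot_piZ -quot_piD scalerDl. Qed.
HB.instance Definition _ := GRing.Zmodule_isLmodule.Build R quot_mod quot_scaleA quot_scale1 quot_scaleDr quot_scaleDl.
Lemma quot_pi_linear : linear quot_pi.
Proof. by move=> a x y; rewrite quot_piD quot_piZ. Qed.
HB.instance Definition _ := GRing.isLinear.Build R M quot_mod _ quot_pi quot_pi_linear.
End Quotient.

Section MaxTopology.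
Variables (R : pzRingType) (M : lmodType R).

Definition max_spec : Type := Max M.
HB.instance Definition _ := Choice.on max_spec.

Definition max_hull (N : submod M) : set max_spec :=
  [set m : max_spec | N `<=` (val m : submod M)].

(* The complements of the sets max_hull N, for N fully invariant, are declared
   as a subbase, because without a hypothesis on M they need not be stable under
   binary intersections. For M projective in sigma[M] they are exactly the open
   sets (closed_max_specE below). *)
HB.instance Definition _ := isSubBaseTopological.Build max_spec
  [set ~` max_hull N | N in Lfi M] id.

End MaxTopology.

Section Closed.
Variables (R : pzRingType) (M : lmodType R).
Implicit Types N K : submod M.

Lemma in_submod N x : x \in submod_mem N = `[< (N : set M) x >].
Proof. by apply/idP/asboolP => [/set_mem|/mem_set]. Qed.

Lemma Submod_closed (A : set M) : A 0 ->
  (forall a x y, A x -> A y -> A (a *: x + y)) ->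
  `[< submod_closed [in A] >].
Proof.
move=> A0 Al; apply/asboolP; split; first exact/mem_set.
by move=> a x y /set_mem Ax /set_mem Ay; apply/mem_set/Al.
Qed.

Lemma submod0 N : (N : set M) 0.
Proof. by apply/set_mem; have [] := submodP N. Qed.

Lemma submodL N a x y : (N : set M) x -> (N : set M) y -> (N : set M) (a *: x + y).
Proof. by move=> Nx Ny; apply/set_mem; have [_] := submodP N; apply; apply/mem_set. Qed.

Definition dsum_ev (f : dsum unit M) : M := val f tt.

Lemma dsum_ev_linear : linear dsum_ev. Proof. by []. Qed.

HB.instance Definition _ :=
  GRing.isLinear.Build R (dsum unit M) M _ dsum_ev dsum_ev_linear.

Lemma in_sigma_submod N : in_sigma M (submod_type N).
Proof.
exists unit, M, dsum_ev, (val : {linear submod_type N -> M}).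
split; last exact: val_inj.
apply/seteqP; split=> // x _.
have fin : (fun=> x) \in @finsupp_pred unit R M by apply/asboolP/finite_finset.
by exists (exist _ (fun=> x) fin : dsum unit M).
Qed.

Lemma max_prime (m N K : submod M) : projective_in_sigma M ->
  Max M m -> Lfi M N -> (N : set M) `&` K `<=` m -> N `<=` m \/ K `<=` m.
Proof.
move=> projM [mT maxm] fiN NKm; have [|/existsNP[n0 /not_implyP[Nn0 mn0]]] := pselect (N `<=` m); first by left.
right; apply: contrapT => /existsNP[k0 /not_implyP[Kk0 mk0]].
pose rho : {linear submod_type K -> quot_mod m} := (@quot_pi _ _ m) \o val.
pose A := [set x | exists k, rho k = quot_pi m x].
have clA : `[< submod_closed [in A] >].
  apply: Submod_closed; first by exists 0; rewrite !linear0.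
  by move=> a x y [k kx] [l ly]; exists (a *: k + l); rewrite !linearP kx ly.
have AT : Submod clA = setT :> set M.
  have [x mx|/= e|//] := maxm (Submod clA).
    exists 0; rewrite linear0 -[LHS](linear0 (@quot_pi _ _ m)).
    apply/quot_piE; rewrite sub0r rpredN; exact/mem_set.
  case: mk0; rewrite -e /=.
  by exists (exist _ k0 (mem_set Kk0) : submod_type K).
have rhoT : range rho = setT.
  apply/seteqP; split=> // y _; rewrite -(quot_reprK y).
  have : (Submod clA : set M) (quot_repr y) by rewrite AT.
  by case=> k <-; exists k.
have [beta betaE] := projM _ (in_sigma_submod K) _ rho (@quot_pi _ _ m) rhoT.
have Nb : (N : set M) (val (beta n0)) by apply: (fiN (val \o beta)); exists n0.
have mb : (m : set M) (val (beta n0)) by apply: NKm; split=> //; apply/set_mem; exact: valP.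
apply: mn0; have /quot_piE/set_mem h := betaE n0.
by have := submodL (-1) h mb; rewrite scaleN1r opprB subrK.
Qed.
End Closed.

Section Hulls.
Variables (R : pzRingType) (M : lmodType R).

Lemma submodT_closed : `[< submod_closed [in [set: M]] >].
Proof. exact: Submod_closed. Qed.

Lemma submodI_closed (N K : submod M) : `[< submod_closed [in (N : set M) `&` K] >].
Proof.
apply: Submod_closed; first by split; exact: submod0.
by move=> a x y [? ?] [? ?]; split; exact: submodL.
Qed.

Lemma max_hullI (N K : submod M) : projective_in_sigma M -> Lfi M N -> Lfi M K ->
  exists2 L, Lfi M L & max_hull L = max_hull N `|` max_hull K.
Proof.
move=> projM fN fK; exists (Submod (submodI_closed N K)).
  move=> f _ [x [Nx Kx] <-]; split; [apply: fN|apply: fK]; by exists x.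
apply/seteqP; split=> m /=; last first.
  by move=> [h|h] x [Nx Kx]; apply: h.
by move=> h; apply: (max_prime projM (set_mem (valP m)) fN h).
Qed.

Lemma max_hull_finI (s : seq (set (max_spec M))) : projective_in_sigma M ->
  {subset s <= [set ~` max_hull N | N in Lfi M]} ->
  exists2 L, Lfi M L & \bigcap_(A in [set` s]) A = ~` max_hull L.
Proof.
move=> projM; elim: s => [|A s IH] h.
  rewrite set_nil bigcap_set0; exists (Submod submodT_closed) => //.
  apply/seteqP; split=> // m _ /= mT.
  have [mnT _] := set_mem (valP m); apply: mnT.
  by apply/seteqP; split=> // x _; exact: mT.
have [|L fL LE] := IH; first by move=> B Bs; apply: h; rewrite inE Bs orbT.
have /h/set_mem[N fN NA] : A \in A :: s by rewrite inE eqxx.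
have [K fK KE] := max_hullI projM fN fL; exists K => //.
have -> : [set` A :: s] = A |` [set` s].
  by apply/seteqP; split=> B /=; rewrite inE => /predU1P.
by rewrite bigcap_setU1 LE -NA KE setCU.
Qed.

Lemma max_hull_bigcap (D : set (submod M)) : D `<=` Lfi M ->
  exists2 L, Lfi M L & max_hull L = \bigcap_(N in D) max_hull N.
Proof.
move=> DL; pose U := [set K : submod M | forall N, D N -> N `<=` K].
pose A := \bigcap_(K in U) (K : set M).
have clA : `[< submod_closed [in A] >].
  apply: Submod_closed; first by move=> K _; exact: submod0.
  by move=> a x y Ax Ay K UK; apply: submodL; [exact: Ax|exact: Ay].
exists (Submod clA).
  move=> f _ [x Ax <-] K UK.
  have clf : `[< submod_closed [in f @^-1` K] >].
    apply: Submod_closed; first by rewrite /= linear0; exact: submod0.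
    by move=> a y z Ky Kz; rewrite /= linearP; exact: submodL.
  apply: (Ax (Submod clf)) => N DN y Ny /=.
  by apply: (UK N DN); apply: (DL _ DN f); exists y.
apply/seteqP; split=> m h.
  by move=> N DN x Nx; apply: h => K UK; apply: (UK N DN).
by move=> x; apply => N DN; exact: (h N DN).
Qed.

Lemma closed_max_specE (C : set (max_spec M)) : projective_in_sigma M ->
  closed C <-> exists2 N, Lfi M N & C = max_hull N.
Proof.
move=> projM; rewrite -[C in closed C]setCK closedC; split.
- case=> D' D'D CE.
  pose D := [set N | Lfi M N /\ D' (~` max_hull N)].
  have DL : D `<=` Lfi M by move=> N [].
  have [L fL LE] := max_hull_bigcap DL; exists L => //.
  rewrite -[C]setCK LE -CE setC_bigcup; apply/seteqP; split=> m h.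
    by move=> N [fN DN]; rewrite -(setCK (max_hull N)); exact: h DN.
  move=> A D'A; have [F FD FA] := D'D _ D'A.
  have [K fK KE] := max_hull_finI projM FD.
  have AK : A = ~` max_hull K by rewrite -KE -FA.
  by rewrite AK setCK; apply: h; split=> //; rewrite -AK.
- case=> N fN ->; exists [set ~` max_hull N]; last by rewrite bigcup_set1.
  by move=> _ ->; apply: (@finI_from1 _ _ _ id); exists N.
Qed.
End Hulls.

(* Main.v *)
Require Import Defs.
From HB Require Import structures.
From mathcomp Require Import all_boot all_order all_algebra.
From mathcomp Require Import all_classical topology.

Local Open Scope classical_set_scope.
Local Open Scope ring_scope.

Import Order.TTheory GRing.Theory.

(** Write V(N) for the set of maximal submodules above N, rad N for their
    intersection, Ann A for Ann_M(A), and Ann n for Ann (Rn). The isomorphism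
    sends N in Psi(M) to rad N; its inverse sends K to
    Ler K = {n | K + Ann n = M}. Both sides are thereby identified with the
    open subsets of Max(M).

    Two facts hold for every self-progenerator M. A proper fully invariant
    submodule lies below a maximal one ([sub_maximal]): any x outside it gives,
    by Zorn, a T maximal among the submodules that contain it and avoid x, and
    since M generates Rx, some endomorphism f with values in Rx is not
    T-valued; the preimage of T under f is maximal. So K + Ann n = M means
    exactly that no maximal submodule contains both ([comaximalP]), which
    depends on K through V(K) only. Moreover M generates Rn, and an equation
    K + Ann n = M shows that maps M -> Rn take their values in K, hence
    Ler K <= K ([ler_sub]).

    The Gelfand condition makes every maximal submodule m fully invariant
    ([maximal_Lfi]): if f does not map m to m, the preimage m' of m is
    another maximal submodule, so there are L' not below m' and N' not below
    m with L'_M N' = 0. As N' + m = M, f lifts modulo m to a map M -> N'.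
    This map kills L', hence f(L') <= m, that is, L' <= m', a contradiction.
    It follows that primitive submodules are the maximal submodules, and
    that the elements of SPm(M) are the K with rad K = K.

    Compactness gives V(Ler K) = V(K) ([sub_maximal_of_ler]). For m not in
    V(K), the Gelfand condition separates m from each l in V(K), and
    compactness of V(K) merges these into one fully invariant A, not below
    m, such that Ann A is below no l in V(K) ([gelfand_separation]); this
    says A <= Ler K, so Ler K is not below m. Consequently Ler K belongs to
    Psi(M), rad (Ler K) = K for K in SPm(M), and Ler (rad N) = Ler N = N for
    N in Psi(M).

    An order isomorphism preserves all joins and meets, so it only remains to
    see that SPm(M) is a frame, which follows from the primeness of maximal
    submodules. *)

(** * Order isomorphisms and frames *)

Section FrameTransfer.
Set Implicit Arguments.
Unset Strict Implicit.
Local Open Scope order_scope.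

Section Iso.
Context {d d'} {L : porderType d} {L' : porderType d'} {f : L -> L'}
  {g : L' -> L}.
Hypothesis fle : forall x y, (f x <= f y) = (x <= y).
Hypothesis gK : cancel g f.

Lemma ubound_iso (A : set L) y : ubound (f @` A) (f y) <-> ubound A y.
Proof.
split=> h x; first by move=> Ax; rewrite -fle; apply: h; exists x.
by move=> [z Az <-]; rewrite fle; exact: h.
Qed.

Lemma lbound_iso (A : set L) y : lbound (f @` A) (f y) <-> lbound A y.
Proof.
split=> h x; first by move=> Ax; rewrite -fle; apply: h; exists x.
by move=> [z Az <-]; rewrite fle; exact: h.
Qed.

Lemma supremums_iso (A : set L) j :
  supremums (f @` A) (f j) <-> supremums A j.
Proof.
split=> -[ub least]; split.
- exact/ubound_iso.
- by move=> y /ubound_iso uy; rewrite -fle; exact: least.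
- exact/ubound_iso.
- by move=> y; rewrite -(gK y) => /ubound_iso uy; rewrite fle; exact: least.
Qed.

Lemma infimums_iso (A : set L) j : infimums (f @` A) (f j) <-> infimums A j.
Proof.
split=> -[lb great]; split.
- exact/lbound_iso.
- by move=> y /lbound_iso ly; rewrite -fle; exact: great.
- exact/lbound_iso.
- by move=> y; rewrite -(gK y) => /lbound_iso ly; rewrite fle; exact: great.
Qed.

Lemma frame_morphism_iso : frame_morphism f.
Proof. by split=> [A j /supremums_iso|A m _ /infimums_iso]. Qed.

Lemma is_frame_iso : is_frame L' -> is_frame L.
Proof.
move=> [sup' distr']; split=> [A|a A j m Aj ajm].
  by have [j] := sup' (f @` A); rewrite -(gK j) => /supremums_iso; exists (g j).
apply/supremums_iso.
have imf2 x y : f @` [set x; y] = [set f x; f y].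
  by rewrite image_setU !image_set1.
have := distr' (f a) (f @` A) (f j) (f m).
rewrite -imf2 => /(_ (proj2 (supremums_iso A j) Aj)).
move=> /(_ (proj2 (infimums_iso _ m) ajm)).
congr (supremums _ _); apply/seteqP; split=> x /=.
  move=> [_ [b Ab <-]]; rewrite -imf2 -(gK x) => /infimums_iso abx.
  by exists (g x) => //; exists b.
move=> [y [b Ab aby] <-]; exists (f b); first by exists b.
by rewrite -imf2; exact/infimums_iso.
Qed.

End Iso.

Lemma frame_isomorphic_of_order d d' (L : porderType d) (L' : porderType d')
    (f : L -> L') :
  (forall x y, (f x <= f y) = (x <= y)) -> (forall y, exists x, f x = y) ->
  is_frame L' -> frame_isomorphic L L'.
Proof.
move=> fle /choice[g gK] fr'.
have fK : cancel f g by move=> x; apply/le_anti; rewrite -!fle gK lexx.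
have gle x y : (g x <= g y) = (x <= y) by rewrite -fle !gK.
split=> //; first exact: is_frame_iso fle gK fr'.
exists f, g; split=> //.
  exact: frame_morphism_iso fle gK.
exact: frame_morphism_iso gle fK.
Qed.

End FrameTransfer.

(** * Linear maps and submodules *)

Section LinearMaps.
Set Implicit Arguments.
Unset Strict Implicit.
Variable R : pzRingType.

Lemma linear_of_fun (A B : lmodType R) (f : A -> B) :
  linear f -> exists g : {linear A -> B}, g =1 f.
Proof.
move=> lf; pose m := GRing.isLinear.Build R A B _ f lf.
by exists (HB.pack f m : {linear A -> B}).
Qed.

Lemma corestrict (A B : lmodType R) (f : {linear A -> B}) (K : submod B) :
  (forall x, (K : set B) (f x)) ->
  exists g : {linear A -> submod_type K}, forall x, val (g x) = f x.
Proof.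
move=> Kf.
have lf : linear (fun x => exist _ (f x) (mem_set (Kf x)) : submod_type K).
  by move=> a x y; apply: val_inj; rewrite /= linearP.
by have [g gE] := linear_of_fun lf; exists g => x; rewrite gE.
Qed.

Lemma mem_submod_type (A : lmodType R) (K : submod A) (x : submod_type K) :
  (K : set A) (val x).
Proof. exact/set_mem/valP. Qed.

Lemma preim_closed (A B : lmodType R) (f : {linear A -> B}) (K : submod B) :
  `[< submod_closed [in f @^-1` K] >].
Proof.
apply: Submod_closed; first by rewrite /= linear0; exact: submod0.
by move=> a x y Kx Ky; rewrite /= linearP; exact: submodL.
Qed.

Lemma ker_closed (A B : lmodType R) (f : {linear A -> B}) :
  `[< submod_closed [in f @^-1` [set 0]] >].
Proof.
apply: Submod_closed => [|a x y fx fy] /=; first by rewrite linear0.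
by rewrite linearP fx fy scaler0 addr0.
Qed.

Lemma im_closed (A B : lmodType R) (f : {linear A -> B}) (K : submod A) :
  `[< submod_closed [in f @` K] >].
Proof.
apply: Submod_closed; first by exists 0; [exact: submod0|rewrite linear0].
move=> a _ _ [x Kx <-] [y Ky <-]; exists (a *: x + y); last by rewrite linearP.
exact: submodL.
Qed.

Lemma sum_closed (A : lmodType R) (N K : submod A) :
  `[< submod_closed [in [set x + y | x in N & y in K]] >].
Proof.
apply: Submod_closed.
  by exists 0; [exact: submod0|exists 0; [exact: submod0|rewrite addr0]].
move=> a _ _ [x Nx [y Ky <-]] [z Nz [t Kt <-]].
exists (a *: x + z); first exact: submodL.
by exists (a *: y + t); [exact: submodL|rewrite scalerDr addrACA].
Qed.

Lemma sub_suml (A : lmodType R) (N K : submod A) :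
  N `<=` Submod (sum_closed N K).
Proof.
by move=> x Nx; exists x => //; exists 0; [exact: submod0|rewrite addr0].
Qed.

Lemma sub_sumr (A : lmodType R) (N K : submod A) :
  K `<=` Submod (sum_closed N K).
Proof.
by move=> x Kx; exists 0; [exact: submod0|exists x => //; rewrite add0r].
Qed.

Lemma bigcap_closed (A : lmodType R) (F : set (submod A)) :
  `[< submod_closed [in \bigcap_(K in F) (K : set A)] >].
Proof.
apply: Submod_closed; first by move=> K _; exact: submod0.
by move=> a x y Fx Fy K FK; apply: submodL; [exact: Fx|exact: Fy].
Qed.

Lemma submodD (A : lmodType R) (K : submod A) x y :
  (K : set A) x -> (K : set A) y -> (K : set A) (x + y).
Proof. by rewrite -{2}(scale1r x); exact: submodL. Qed.

Lemma submodZ (A : lmodType R) (K : submod A) a x :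
  (K : set A) x -> (K : set A) (a *: x).
Proof. by move=> Kx; rewrite -[_ *: _]addr0; apply: submodL (submod0 _). Qed.

Lemma submodB (A : lmodType R) (K : submod A) x y :
  (K : set A) x -> (K : set A) y -> (K : set A) (x - y).
Proof. by move=> Kx Ky; rewrite -scaleN1r; apply/submodD/submodZ. Qed.

Lemma cyclic_id (A : lmodType R) (n : A) : (cyclic n : set A) n.
Proof. by exists 1; rewrite ?scale1r. Qed.

Lemma cyclic_sub (A : lmodType R) (n : A) (K : submod A) :
  (K : set A) n -> cyclic n `<=` K.
Proof. by move=> Kn _ [a _ <-]; exact: submodZ. Qed.

Lemma submod_eq (A : lmodType R) (N K : submod A) :
  N = K :> set A -> N = K.
Proof. by move=> NK; exact: val_inj. Qed.

(** Zorn's lemma is applied to the sets X such that X `|` H is a submodule,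
    rather than to the submodules above H themselves, so that the empty chain
    has an upper bound. *)
Lemma maximal_avoiding (A : lmodType R) (H : submod A) x : ~ (H : set A) x ->
  exists T : submod A, [/\ H `<=` T, ~ (T : set A) x &
    forall K : submod A, T `<=` K -> ~ (K : set A) x -> K `<=` T].
Proof.
move=> Hx.
pose P (X : set A) := ~ (X `|` H) x /\
  forall a y z, (X `|` H) y -> (X `|` H) z -> (X `|` H) (a *: y + z).
have [|X [[Xx clX] maxX]] := @Zorn_bigcup A P.
  move=> F FP totF; split.
    by move=> [[X FX Xx]|//]; apply: (FP X FX).1; left.
  have up X y : F X -> (X `|` H) y -> (\bigcup_(X in F) X `|` H) y.
    by move=> FX [Xy|Hy]; [left; exists X|right].
  move=> a y z [[X FX Xy]|Hy] [[Y FY Yz]|Hz].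
  - have [XY|YX] := totF _ _ FX FY.
      by apply: (up Y) => //; apply: (FP Y FY).2; left => //; exact: XY.
    by apply: (up X) => //; apply: (FP X FX).2; left => //; exact: YX.
  - by apply: (up X) => //; apply: (FP X FX).2; [left|right].
  - by apply: (up Y) => //; apply: (FP Y FY).2; [right|left].
  - by right; exact: submodL.
have clT : `[< submod_closed [in X `|` H] >].
  by apply: Submod_closed => //; right; exact: submod0.
exists (Submod clT); split=> //= K TK Kx y Ky; apply: contrapT => XHy.
apply: (maxX K).
  by split=> [z Xz|/(_ y Ky) Xy]; [apply: TK; left|apply: XHy; left].
have KH : (K : set A) `|` H = K.
  by apply/seteqP; split=> [z [//|Hz]|z]; [apply: TK; right|left].
by rewrite /P KH; split=> // a u v; exact: submodL.
Qed.

End LinearMaps.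

(** * Direct sums and generation *)

Section Generation.
Set Implicit Arguments.
Unset Strict Implicit.
Variables (R : pzRingType) (M : lmodType R).

Lemma dsum_injection (X : Type) (i : X) :
  exists f : {linear M -> dsum X M},
    forall x j, val (f x) j = if `[< j = i >] then x else 0.
Proof.
pose c x : X -> M := fun j => if `[< j = i >] then x else 0.
have cfin x : c x \in @finsupp_pred X R M.
  apply/asboolP; apply: (@sub_finite_set _ _ [set i]) => //.
  by move=> j /=; rewrite /c; case: asboolP.
have lin : linear (fun x => exist _ (c x) (cfin x) : dsum X M).
  move=> a x y; apply: val_inj; apply/funext => j /=.
  transitivity (a *: c x j + c y j); last by [].
  by rewrite /c; case: asboolP => // _; rewrite scaler0 addr0.
by have [f fE] := linear_of_fun lin; exists f => x j; rewrite fE.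
Qed.

(** Induction on the support: subtracting from u its component at i removes i
    from the support. *)
Lemma dsum_ind (X : Type) (D : submod (dsum X M)) :
  (forall (f : {linear M -> dsum X M}) x, (D : set _) (f x)) ->
  forall u, (D : set _) u.
Proof.
move=> Df u; have /asboolP : val u \in @finsupp_pred X R M by exact: valP.
move=> /(@finite_seqP {classic X})[s] sE.
have {sE} : forall j : {classic X}, j \notin s -> val u j = 0.
  move=> j js; apply: contrapT => uj; move/negP: js; apply.
  by have : [set x | val u x <> 0] j by []; rewrite sE.
elim: s u => [|i s IH] u us.
  suff -> : u = 0 by exact: submod0.
  by apply: val_inj; apply/funext => j; rewrite us.
have [f fE] := dsum_injection (i : X).
rewrite -[u](subrK (f (val u i))); apply: submodD; last exact: Df.
apply: IH => j js.
transitivity (val u j - val (f (val u i)) j); first by [].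
rewrite fE; case: asboolP => [->|ji]; first by rewrite subrr.
rewrite subr0; apply: us; rewrite inE negb_or js andbT.
by apply/eqP.
Qed.

(** Generation of K in terms of endomorphisms of M: K is the sum of the images
    of those with values in K, so K <= T can be tested on these images. *)
Lemma sub_of_trace (K T : submod M) : generated M (submod_type K) ->
  (forall f : {linear M -> M}, (forall y, (K : set M) (f y)) ->
     forall y, (T : set M) (f y)) -> K `<=` T.
Proof.
move=> [X [p pT]] KT x Kx.
have [u _ ux] : range p (exist _ x (mem_set Kx) : submod_type K).
  by rewrite pT.
pose q : {linear dsum X M -> M} :=
  (val : {linear submod_type K -> M}) \o p.
have := @dsum_ind X (Submod (preim_closed q T)) _ u.
rewrite /= ux; apply=> f y /=.
apply: (KT (q \o f)) => z; exact: mem_submod_type.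
Qed.

End Generation.

(** * Projectivity, fully invariant submodules and annihilators *)

Section Module.
Set Implicit Arguments.
Unset Strict Implicit.
Variables (R : pzRingType) (M : lmodType R).

Lemma in_sigma_quotient (Q : lmodType R) (p : {linear M -> Q}) :
  range p = setT -> in_sigma M Q.
Proof.
move=> pT; exists unit, Q, (p \o @dsum_ev R M), idfun; split; last by [].
apply/seteqP; split=> // y _; have [x _ <-] : range p y by rewrite pT.
have fin : (fun=> x) \in @finsupp_pred unit R M by apply/asboolP/finite_finset.
by exists (exist _ (fun=> x) fin : dsum unit M).
Qed.

Lemma range_quot_pi (m : submod M) : range (quot_pi m) = setT.
Proof.
by apply/seteqP; split=> // y _; exists (quot_repr y); rewrite // quot_reprK.
Qed.

Lemma quot_pi_eq0 (m : submod M) x : quot_pi m x = 0 <-> (m : set M) x.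
Proof.
rewrite -(linear0 (@quot_pi _ _ m)) quot_piE subr0.
by split=> [/set_mem|/mem_set].
Qed.

(** It is enough that rho reaches the values of alpha, because both maps can be
    corestricted to the image of rho. This spares checking surjectivity at each
    use. *)
Lemma projective_lift (N X : lmodType R) (rho : {linear N -> X})
    (alpha : {linear M -> X}) :
  projective_in_sigma M -> in_sigma M N ->
  (forall x, exists y, rho y = alpha x) ->
  exists beta : {linear M -> N}, forall x, rho (beta x) = alpha x.
Proof.
move=> projM sN ar.
pose I := Submod (im_closed rho (Submod (@submodT_closed _ N))).
have rI y : (I : set X) (rho y) by exists y.
have [rho' rE] := corestrict rI.
have aI x : (I : set X) (alpha x) by have [y <-] := ar x; exists y.
have [alpha' aE] := corestrict aI.
have [|beta bE] := projM _ sN _ rho' alpha'.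
  apply/seteqP; split=> // y _.
  have [z _ zy] := mem_submod_type y; exists z => //.
  by apply: val_inj; rewrite rE.
by exists beta => x; rewrite -rE bE.
Qed.

Lemma fully_invariant_app (N : submod M) (f : {linear M -> M}) x :
  Lfi M N -> (N : set M) x -> (N : set M) (f x).
Proof. by move=> fiN Nx; apply: (fiN f); exists x. Qed.

Lemma annM_closed (K : lmodType R) : `[< submod_closed [in annM M K] >].
Proof.
apply: Submod_closed; first by move=> f _ /=; rewrite linear0.
move=> a x y Kx Ky f _ /=.
by rewrite linearP (Kx f I) (Ky f I) scaler0 addr0.
Qed.

Definition ann (K : lmodType R) : submod M := Submod (annM_closed K).

Lemma Lfi_ann K : Lfi M (ann K).
Proof. by move=> f _ [x Kx <-] g _; exact: (Kx (g \o f)). Qed.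

Lemma ann_submodP (K : submod M) x :
  (ann (submod_type K) : set M) x <->
  forall f : {linear M -> M}, (forall y, (K : set M) (f y)) -> f x = 0.
Proof.
split=> [Kx f fK|h f _ /=].
  by have [g gE] := corestrict fK; rewrite -gE (Kx g I).
apply: val_inj; exact: (h (val \o f) (fun y => mem_submod_type (f y))).
Qed.

Lemma ann_anti (N K : submod M) : N `<=` K ->
  ann (submod_type K) `<=` ann (submod_type N).
Proof.
move=> NK x /ann_submodP Kx; apply/ann_submodP => f fN; apply: Kx => y.
exact/NK/fN.
Qed.

Lemma prodM_eq0P (N K : submod M) :
  prodM N K = [set 0] <-> N `<=` ann (submod_type K).
Proof.
split=> [NK x Nx f _|NK].
  apply: val_inj; suff : prodM N K (val (f x)) by rewrite NK.
  exists [:: val (f x)]; last by rewrite big_seq1.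
  move=> y; rewrite inE => /eqP ->; exists (val @` (f @` N)); first by exists f.
  by exists (f x) => //; exists x.
apply/seteqP; split=> [x [s sP ->]|_ ->]; last first.
  by exists [::]; rewrite // big_nil.
rewrite big_seq big1 // => y /sP[_ [f _ <-] [_ [z Nz <-] <-]].
by rewrite (NK z Nz f I).
Qed.

Lemma Lfi_sum (N K : submod M) :
  Lfi M N -> Lfi M K -> Lfi M (Submod (sum_closed N K)).
Proof.
move=> fN fK f _ [_ [x Nx [y Ky <-]] <-]; exists (f x).
  exact: fully_invariant_app.
by exists (f y); [exact: fully_invariant_app|rewrite linearD].
Qed.

Lemma Lfi_submodI (N K : submod M) :
  Lfi M N -> Lfi M K -> Lfi M (Submod (submodI_closed N K)).
Proof.
by move=> fN fK f _ [x [Nx Kx] <-]; split; exact: fully_invariant_app.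
Qed.

Lemma Lfi_bigcap (F : set (submod M)) :
  F `<=` Lfi M -> Lfi M (Submod (bigcap_closed F)).
Proof.
move=> FL f _ [x Fx <-] K FK.
by apply: fully_invariant_app (Fx K FK); exact: FL.
Qed.

(** * Maximal submodules *)

Hypothesis projM : projective_in_sigma M.
Hypothesis genM : forall N : submod M, generated M (submod_type N).

Lemma in_sigma_self : in_sigma M M.
Proof.
by apply: (@in_sigma_quotient M idfun); apply/seteqP; split=> // x _; exists x.
Qed.

(** The hypothesis on T is what remains of maximality when T is only maximal
    relative to the values of f. It covers a maximal T and any f, as well as a T
    maximal among the submodules avoiding x and an f with values in Rx. *)
Lemma maximal_preim_of_cover (T : submod M) (f : {linear M -> M}) :
  (forall L : submod M, T `<=` L -> ~ (L `<=` T) ->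
     forall y, (L : set M) (f y)) ->
  ~ (forall y, (T : set M) (f y)) -> Max M (Submod (preim_closed f T)).
Proof.
move=> maxT fT; split=> /= [e|K mK].
  by apply: fT => y; have : (f @^-1` T) y by rewrite e.
have [fKT|fKT] := pselect (f @` K `<=` T).
  left; apply: submod_eq; apply/seteqP; split=> //= y Ky.
  by apply: fKT; exists y.
right; apply/seteqP; split=> // y _.
pose L := Submod (sum_closed T (Submod (im_closed f K))).
have [|LT|t Tt [_ [k Kk <-] tky]] := maxT L _ _ y.
- exact: sub_suml.
- by apply: fKT => z fKz; apply/LT/sub_sumr.
rewrite -[y](subrK k); apply: submodD => //; apply: mK.
by rewrite /= linearB /= -tky addrK.
Qed.

Lemma maximal_preim (m : submod M) (f : {linear M -> M}) : Max M m ->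
  ~ (forall x, (m : set M) (f x)) -> Max M (Submod (preim_closed f m)).
Proof.
move=> [mT maxm] mf; apply: maximal_preim_of_cover mf => L mL Lm y.
by have [e|->//] := maxm L mL; case: Lm; rewrite e.
Qed.

Lemma maximal_sum (m K : submod M) y : Max M m -> ~ (K `<=` m) ->
  exists2 k, (K : set M) k & (m : set M) (y - k).
Proof.
move=> [_ maxm] Km; pose L := Submod (sum_closed m K).
have [|e|LT] := maxm L.
- exact: sub_suml.
- by case: Km => k Kk; rewrite -e; exact: sub_sumr.
have [u mu [k Kk <-]] : (L : set M) y by rewrite LT.
by exists k; rewrite // addrK.
Qed.

(** Zorn's lemma does not apply to M directly, which need not be finitely
    generated. It gives T avoiding a point x outside H, and the preimage of T
    under an endomorphism with values in Rx is maximal; full invariance puts H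
    below this preimage. *)
Lemma sub_maximal (H : submod M) : Lfi M H -> H <> setT :> set M ->
  exists2 m, Max M m & H `<=` m.
Proof.
move=> fiH HT; have [x Hx] : exists x, ~ (H : set M) x.
  apply: contrapT => h; apply: HT; apply/seteqP; split=> // x _.
  by apply: contrapT => Hx; apply: h; exists x.
have [T [HT' Tx maxT]] := maximal_avoiding Hx.
have [f fx fT] : exists2 f : {linear M -> M},
    (forall y, (cyclic x : set M) (f y)) & ~ (forall y, (T : set M) (f y)).
  apply: contrapT => h; apply: Tx; apply: (sub_of_trace (genM (cyclic x))).
    by move=> f fx; apply: contrapT => fT; apply: h; exists f.
  exact: cyclic_id.
exists (Submod (preim_closed f T)); last first.
  by move=> y Hy; apply: HT'; exact: fully_invariant_app.
apply: maximal_preim_of_cover fT => L TL LT y; apply: cyclic_sub (fx y).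
by apply: contrapT => Lx; apply: LT; exact: maxT.
Qed.

Lemma comaximalP (N K : submod M) : Lfi M N -> Lfi M K ->
  [set x + y | x in N & y in K] = setT <->
  forall m, Max M m -> N `<=` m -> K `<=` m -> False.
Proof.
move=> fN fK; split=> [NK m [mT _] Nm Km|h].
  apply: mT; apply/seteqP; split=> // z _.
  have [x Nx [y Ky <-]] : [set x + y | x in N & y in K] z by rewrite NK.
  by apply: submodD; [exact: Nm|exact: Km].
apply: contrapT => NKT.
have [m mm NKm] := sub_maximal (Lfi_sum fN fK) NKT.
apply: (h m mm) => x Hx; apply: NKm.
  exact: sub_suml.
exact: sub_sumr.
Qed.

(** A map f : M -> R(an + n') splits as g + h with g : M -> Rn and
    h : M -> Rn': g lifts f modulo Rn' along Rn, and h = f - g. *)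
Lemma ann_cyclic_linear a (n n' : M) :
  ann (submod_type (cyclic n)) `&` ann (submod_type (cyclic n'))
    `<=` ann (submod_type (cyclic (a *: n + n'))).
Proof.
move=> x [/ann_submodP nx /ann_submodP n'x]; apply/ann_submodP => f fE.
set q : {linear M -> quot_mod (cyclic n')} := @quot_pi _ _ (cyclic n').
have [|g gE] := @projective_lift _ _
    (q \o val : {linear submod_type (cyclic n) -> _})
    (q \o f) projM (in_sigma_submod (cyclic n)).
  move=> y; have [b _ bE] := fE y.
  have cb : (cyclic n : set M) ((b * a) *: n) by exists (b * a).
  exists (exist _ ((b * a) *: n) (mem_set cb) : submod_type (cyclic n)).
  apply/quot_piE/mem_set => /=.
  by exists (- b) => //; rewrite -bE scalerDr scalerA opprD addNKr scaleNr.
have gx : val (g x) = 0.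
  by apply: (nx (val \o g)) => y; exact: mem_submod_type.
have : f x - val (g x) = 0.
  apply: (n'x (f \- (val \o g))) => y /=.
  by have /esym/quot_piE/set_mem := gE y.
by rewrite gx subr0.
Qed.

(** A map M -> R(f n) lifts along the surjection f : Rn -> R(f n). *)
Lemma ann_cyclic_app (f : {linear M -> M}) (n : M) :
  ann (submod_type (cyclic n)) `<=` ann (submod_type (cyclic (f n))).
Proof.
move=> x /ann_submodP nx; apply/ann_submodP => h hE.
have [|g gE] := @projective_lift _ _
    (f \o val : {linear submod_type (cyclic n) -> _})
    h projM (in_sigma_submod (cyclic n)).
  move=> y; have [b _ bE] := hE y.
  have cb : (cyclic n : set M) (b *: n) by exists b.
  by exists (exist _ (b *: n) (mem_set cb) : submod_type (cyclic n));
    rewrite /= linearZ.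
have gx : val (g x) = 0.
  by apply: (nx (val \o g)) => y; exact: mem_submod_type.
by rewrite -gE /= gx linear0.
Qed.

Lemma ann_cyclic0 x : (ann (submod_type (cyclic (0 : M))) : set M) x.
Proof.
by apply/ann_submodP => f f0; have [a _ <-] := f0 x; rewrite scaler0.
Qed.

(** * The operator Ler *)

Definition ler_set (K : submod M) : set M :=
  [set n | [set x + y | x in K & y in annM M (submod_type (cyclic n))] = setT].

Lemma ler_setP (K : submod M) n : Lfi M K ->
  ler_set K n <-> forall m, Max M m -> K `<=` m ->
    ann (submod_type (cyclic n)) `<=` m -> False.
Proof. by move=> fK; exact: (comaximalP fK (@Lfi_ann _)). Qed.

Lemma ler_closed (K : submod M) : Lfi M K ->
  `[< submod_closed [in ler_set K] >].
Proof.
move=> fK; apply: Submod_closed.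
  apply/ler_setP => // m [mT _] _ am; apply: mT; apply/seteqP; split=> // x _.
  exact/am/ann_cyclic0.
move=> a n n' /(ler_setP _ fK) Kn /(ler_setP _ fK) Kn'.
apply/ler_setP => // m mm Km am.
have [|am'|am'] := @max_prime _ _ m (ann (submod_type (cyclic n)))
   (ann (submod_type (cyclic n'))) projM mm (@Lfi_ann _).
- by move=> x nx; exact/am/ann_cyclic_linear.
- exact: (Kn m).
- exact: (Kn' m).
Qed.

Definition ler (K : submod M) (fK : Lfi M K) : submod M :=
  Submod (ler_closed fK).

Lemma Lfi_ler (K : submod M) (fK : Lfi M K) : Lfi M (ler fK).
Proof.
move=> f _ [n /(ler_setP _ fK) Kn <-]; apply/ler_setP => // m mm Km am.
by apply: (Kn m mm Km) => x nx; exact/am/ann_cyclic_app.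
Qed.

(** A map f : M -> Rn vanishes on Ann n, so its values on M = K + Ann n are
    those on K, and they lie in K. The module Rn is the sum of the images of
    such maps. *)
Lemma ler_sub (K : submod M) : Lfi M K -> ler_set K `<=` K.
Proof.
move=> fK n Kn; apply: (sub_of_trace (genM (cyclic n))) (cyclic_id n) => f fn y.
have [k Kk [x nx <-]] :
  [set x + y | x in K & y in annM M (submod_type (cyclic n))] y by rewrite Kn.
move/ann_submodP: nx => /(_ f fn) fx.
by rewrite linearD fx addr0; exact: fully_invariant_app.
Qed.

(** * Primitive submodules of a Gelfand module *)

Hypothesis gel : gelfand M.

(** If f does not preserve m, the preimage of m under f is a second maximal
    submodule, and the Gelfand condition cannot separate it from m. *)
Lemma maximal_Lfi (m : submod M) : Max M m -> Lfi M m.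
Proof.
move=> mm f _ [x mx <-]; apply: contrapT => mfx.
have mf : ~ (forall x, (m : set M) (f x)) by [].
have mm' := maximal_preim mm mf.
have [|N [L [_ _ Lm' Nm /prodM_eq0P LN]]] := gel mm mm'.
  by move=> e; apply: mfx; move: mx; rewrite {1}e.
apply: Lm' => y Ly /=.
(* Modulo m, f factors through N, as N + m = M; L is killed on the way. *)
have [|g gE] := @projective_lift _ _
    (@quot_pi _ _ m \o val : {linear submod_type N -> _})
    (@quot_pi _ _ m \o f) projM (in_sigma_submod N).
  move=> z; have [k Nk mk] := maximal_sum (f z) mm Nm.
  exists (exist _ k (mem_set Nk) : submod_type N); apply/esym/quot_piE/mem_set.
  exact: mk.
have /= := gE y; rewrite (LN y Ly g I : g y = 0) linear0.
by move=> /esym /quot_pi_eq0.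
Qed.

(** Every map M -> S is f composed with an endomorphism, and endomorphisms
    preserve the kernel m of f. *)
Lemma ann_eq_ker (S : lmodType R) (f : {linear M -> S}) (m : submod M) :
  Max M m -> m = f @^-1` [set 0] :> set M -> range f = setT ->
  annM M S = m :> set M.
Proof.
move=> mm mE fT; apply/seteqP; split=> x; first by rewrite mE; apply.
move=> mx g _ /=; have [|h hE] := @projective_lift _ _ f g projM in_sigma_self.
  move=> y; have [z _ zy] : range f (g y) by rewrite fT.
  by exists z.
rewrite -hE; have : (m : set M) (h x).
  by apply: fully_invariant_app mx; exact: maximal_Lfi.
by rewrite mE.
Qed.

Lemma ker_simple_maximal (S : lmodType R) (f : {linear M -> S}) (m : submod M) :
  simple_module S -> m = f @^-1` [set 0] :> set M -> m <> setT :> set M ->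
  Max M m /\ range f = setT.
Proof.
move=> [_ simS] mE mT.
have imf (K : submod M) :
    m `<=` K -> K = m \/ K = setT :> set M /\ range f = setT.
  move=> mK; have [/= f0|/= fT] := simS (Submod (im_closed f K)); [left|right].
    apply: submod_eq; apply/seteqP; split=> // x Kx; rewrite mE /=.
    by have : (f @` K) (f x) by [exists x]; rewrite f0.
  split; last first.
    apply/seteqP; split=> // y _.
    by have [x _ <-] : (f @` K) y by [rewrite fT]; exists x.
  apply/seteqP; split=> // x _.
  have [k Kk kx] : (f @` K) (f x) by rewrite fT.
  rewrite -[x](subrK k); apply: submodD => //; apply: mK; rewrite mE /=.
  by rewrite linearB kx subrr.
split; first by split=> // K /imf[->|[-> _]]; [left|right].
have [|e|[_ //]] := imf (Submod (@submodT_closed _ M)) => //.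
by case: mT; rewrite -e.
Qed.

(** A simple S with a nonzero map from M is M/m for the kernel m of that map,
    and Ann_M (M/m) = m. *)
Lemma primitive_eq_Max : primitive M = Max M.
Proof.
apply/seteqP; split=> m.
  move=> [_ mT [S [simS _ mE]]].
  have [f f0] : exists f : {linear M -> S}, f @^-1` [set 0] <> setT.
    apply: contrapT => h; apply: mT; rewrite mE.
    apply/seteqP; split=> // x _ f _.
    apply: contrapT => fx; apply: h; exists f => fT.
    by apply: fx; rewrite fT.
  have [mf fT] := @ker_simple_maximal _ f (Submod (ker_closed f)) simS erefl f0.
  suff -> : m = Submod (ker_closed f) by [].
  by apply: submod_eq; rewrite mE; exact: (ann_eq_ker mf erefl fT).
move=> mm; have [mT maxm] := mm; split=> //; first exact: maximal_Lfi.
exists (quot_mod m); split.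
- split.
    apply: contrapT => h; apply: mT; apply/seteqP; split=> // x _.
    apply: contrapT => mx; apply: h; exists (quot_pi m x) => /quot_pi_eq0.
    exact: mx.
  move=> K; pose L := Submod (preim_closed (@quot_pi _ _ m) K).
  have [|e|e] := maxm L.
  + by move=> x /quot_pi_eq0 x0; rewrite /= x0; exact: submod0.
  + left; apply/seteqP; split=> y; last by move=> ->; exact: submod0.
    rewrite -(quot_reprK y); move: (quot_repr y) => x Kx.
    by apply/quot_pi_eq0; rewrite -e.
  + right; apply/seteqP; split=> // y _; rewrite -(quot_reprK y).
    by have : (L : set M) (quot_repr y) by rewrite e.
- exact: (in_sigma_quotient (range_quot_pi m)).
- apply/esym/(@ann_eq_ker _ (@quot_pi _ _ m)) => //; last exact: range_quot_pi.
  by apply/seteqP; split=> x /quot_pi_eq0.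
Qed.

(** * Separation in a compact maximal spectrum *)

Lemma open_max_hullC (N : submod M) : Lfi M N -> open (~` max_hull N).
Proof. by move=> fN; apply/closed_openC/closed_max_specE => //; exists N. Qed.

Hypothesis comp : compact [set: max_spec M].

(** Each l in V(K) is separated from m by some A with Ann A not below l, and
    this A also serves for all l' near l. Any smaller A keeps the property, and
    the admissible A (fully invariant, not below m) are closed under binary
    intersections because m is prime; so compactness of V(K), in its
    near-covering form along the filter of small A, yields one A for all l. *)
Lemma gelfand_separation (m K : submod M) :
  Max M m -> Lfi M K -> ~ (K `<=` m) ->
  exists2 A, Lfi M A /\ ~ (A `<=` m) &
    forall l, Max M l -> K `<=` l -> ~ (ann (submod_type A) `<=` l).
Proof.
move=> mm fK Km.
have /compact_near_coveringP near : compact (max_hull K).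
  apply: (subclosed_compact _ comp) => //.
  by apply/closed_max_specE => //; exists K.
pose D : set (submod M) := [set A | Lfi M A /\ ~ (A `<=` m)].
pose P (A : submod M) (l : max_spec M) :=
  ~ (ann (submod_type A) `<=` (val l : submod M)).
have FF : Filter (filter_from D (fun A => [set B : submod M | B `<=` A])).
  apply: filter_from_filter.
    exists (Submod (@submodT_closed _ M)); split=> [//|/= h].
    by apply: mm.1; apply/seteqP; split=> // x _; exact: h.
  move=> A B [fA Am] [fB Bm]; exists (Submod (submodI_closed A B)).
    by split=> [|/(max_prime projM mm fA)[]//]; exact: Lfi_submodI.
  by move=> C CAB; split=> x /CAB[].
have [|A [fA Am] AP] := near _ _ P FF.
  move=> l Kl.
  have ml : m <> val l by move=> e; apply: Km; rewrite e.
  have [N [L [fN fL Ll Nm /prodM_eq0P LN]]] := gel mm (set_mem (valP l)) ml.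
  exists (~` max_hull L, [set B : submod M | B `<=` N]).
    split; last by exists N.
    by apply: open_nbhs_nbhs; split=> //; exact: open_max_hullC.
  move=> [l' B] /= [Ll' BN] aB; apply: Ll' => x /LN Nx; apply: aB.
  exact: ann_anti Nx.
exists A; first by split.
move=> l ml Kl; have AK : [set B : submod M | B `<=` A] A by [].
exact: (AP A AK (exist _ l (mem_set ml)) Kl).
Qed.

Lemma sub_maximal_of_ler (m K : submod M) : Max M m -> Lfi M K ->
  ler_set K `<=` m -> K `<=` m.
Proof.
move=> mm fK lm; apply: contrapT => Km.
have [A [fA Am] sep] := gelfand_separation mm fK Km.
apply: Am => n An; apply/lm/ler_setP => // l ml Kl al; apply: (sep l ml Kl).
by move=> x /(ann_anti (cyclic_sub An)); exact: al.
Qed.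

(** Membership of n in Ler K depends on K through V(K), and V(Ler K) = V(K). *)
Lemma Psi_ler (K : submod M) (fK : Lfi M K) : Psi M (ler fK).
Proof.
split=> [|n Kn]; first exact: Lfi_ler.
apply: (proj2 (ler_setP n (@Lfi_ler K fK))) => m mm lm am.
by move/(ler_setP _ fK): Kn => /(_ m mm (sub_maximal_of_ler mm fK lm) am).
Qed.

(** * Semiprimitive submodules and the isomorphism *)

Definition rad (K : submod M) : submod M :=
  Submod (bigcap_closed [set m | Max M m /\ K `<=` m]).

Lemma sub_rad (K : submod M) : K `<=` rad K.
Proof. by move=> x Kx m [_]; apply. Qed.

Lemma rad_sub (K m : submod M) : Max M m -> K `<=` m -> rad K `<=` m.
Proof. by move=> mm Km x; apply. Qed.

Lemma SPmP (K : submod M) : SPm M K <-> rad K `<=` K.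
Proof.
rewrite /SPm /semiprimitive primitive_eq_Max; split.
  move=> [->//|[F FM KE] x rx]; rewrite KE => P FP; apply: rx.
  by split; [exact: FM|move=> y; rewrite KE; apply].
move=> rK; right; exists [set m | Max M m /\ K `<=` m]; first by move=> m [].
by apply/seteqP; split; [exact: sub_rad|exact: rK].
Qed.

(** N <= Ler N by definition of Psi, Ler depends on V only, and Ler K <= K. *)
Lemma Psi_sub_of_rad (N K : submod M) :
  Psi M N -> Psi M K -> rad N `<=` rad K -> N `<=` K.
Proof.
move=> [fN pN] [fK pK] rNK n Nn; apply: (ler_sub fK).
apply/ler_setP => // m mm Km am.
apply: (proj1 (ler_setP n fN) (pN n Nn) m mm _ am).
by move=> x /sub_rad/rNK; exact: rad_sub.
Qed.

Lemma SPm_leP (x y : SPm M) :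
  (x <= y)%O <-> (val x : submod M) `<=` (val y : submod M).
Proof. by rewrite -subsetEset. Qed.

Lemma Psi_leP (x y : Psi M) :
  (x <= y)%O <-> (val x : submod M) `<=` (val y : submod M).
Proof. by rewrite -subsetEset. Qed.

Lemma SPm_bigcap (F : set (submod M)) :
  F `<=` Max M -> SPm M (Submod (bigcap_closed F)).
Proof.
move=> FM; apply/SPmP => x rx m Fm; apply: rx.
by split; [exact: FM|move=> y; apply].
Qed.

Lemma SPm_rad (K : submod M) : SPm M (rad K).
Proof. by apply: SPm_bigcap => m []. Qed.

Lemma SPm_valP (x : SPm M) : rad (val x) `<=` (val x : submod M).
Proof. exact/SPmP/set_mem/valP. Qed.

Lemma Max_SPm : Max M `<=` SPm M.
Proof. by move=> m mm; apply/SPmP; exact: rad_sub. Qed.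

Lemma SPm_Lfi : SPm M `<=` Lfi M.
Proof.
move=> K /SPmP rK; suff -> : K = rad K.
  by apply: Lfi_bigcap => m [mm _]; exact: maximal_Lfi.
by apply/submod_eq/seteqP; split; [exact: sub_rad|exact: rK].
Qed.

Lemma SPm_submodI (N K : submod M) :
  SPm M N -> SPm M K -> SPm M (Submod (submodI_closed N K)).
Proof.
move=> /SPmP rN /SPmP rK; apply/SPmP => x rx; split.
  by apply: rN => m [mm Nm]; apply: rx; split=> // y [/Nm].
by apply: rK => m [mm Km]; apply: rx; split=> // y [_ /Km].
Qed.

Lemma SPm_infimums2 (a b : SPm M) :
  exists2 x, infimums [set a; b] x &
    val x = Submod (submodI_closed (val a) (val b)).
Proof.
have abS := SPm_submodI (set_mem (valP a)) (set_mem (valP b)).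
exists (exist _ (Submod _) (mem_set abS)) => //.
split=> [y /= ab|y ly]; first by apply/SPm_leP; case: ab => -> z [].
by apply/SPm_leP => z yz; split; apply: (proj1 (SPm_leP y _)) z yz;
  apply: ly; [left|right].
Qed.

(** The join of A is the intersection of the maximal submodules above all of A.
    For distributivity, let l be maximal above every a `&` b with b in A: as l
    is prime, it is above a or above all of A, hence above the join of A. *)
Lemma SPm_frame : is_frame (SPm M).
Proof.
split=> [A|a A j m [Aj lj] [ajm gm]].
  pose F := [set m | Max M m /\
    forall a : SPm M, A a -> (val a : submod M) `<=` m].
  have FM : F `<=` Max M by move=> m [].
  exists (exist _ (Submod _) (mem_set (SPm_bigcap FM))); split.
    by move=> a Aa; apply/SPm_leP => x ax m [_ h]; exact: h ax.
  move=> u ub; apply/SPm_leP => x Fx; apply: SPm_valP => m [mm um].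
  apply: Fx; split=> // a Aa y ay; apply: um.
  exact: (proj1 (SPm_leP a u) (ub a Aa)) y ay.
have ma : (m <= a)%O by apply: ajm; left.
have mj : (m <= j)%O by apply: ajm; right.
split=> [x [b Ab [abx _]]|u ub].
  apply: gm => y [->|->]; first by apply: abx; left.
  by apply: le_trans (Aj b Ab); apply: abx; right.
apply/SPm_leP => x mx; apply: SPm_valP => l [ml ul].
have [al|al] := pselect ((val a : submod M) `<=` l).
  exact/al/(proj1 (SPm_leP m a) ma).
pose L : SPm M := exist _ l (mem_set (Max_SPm ml)).
have jL : (j <= L)%O.
  apply: lj => b Ab; apply/SPm_leP.
  have [y aby yE] := SPm_infimums2 a b.
  have yu : (y <= u)%O by apply: ub; exists b.
  have [||/al//|//] := @max_prime _ _ l (val a) (val b) projM ml.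
  - exact/SPm_Lfi/set_mem/valP.
  - by move: (proj1 (SPm_leP y u) yu); rewrite yE => abu z /abu /ul.
exact: (proj1 (SPm_leP m L) (le_trans mj jL)).
Qed.

Lemma Psi_frame_isomorphic : frame_isomorphic (Psi M) (SPm M).
Proof.
pose f (x : Psi M) : SPm M := exist _ (rad (val x)) (mem_set (SPm_rad (val x))).
apply: (@frame_isomorphic_of_order _ _ _ _ f); last exact: SPm_frame.
  move=> x y; apply/idP/idP => [/SPm_leP/= rxy|/Psi_leP xy].
    by apply/Psi_leP; apply: Psi_sub_of_rad rxy; exact/set_mem/valP.
  apply/SPm_leP => z /= rz m [mm ym]; apply: rz; split=> // t xt.
  exact/ym/xy.
move=> y.
have fy : Lfi M (val y) by exact/SPm_Lfi/set_mem/valP.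
exists (exist _ (ler fy) (mem_set (Psi_ler fy))).
apply/val_inj/submod_eq/seteqP; split=> /= x rx.
  apply: SPm_valP => m [mm ym]; apply: rx; split=> // z lz.
  by apply: ym; exact: ler_sub lz.
move=> m [mm lm]; exact: (sub_maximal_of_ler mm fy lm).
Qed.

End Module.

Theorem theorem5p15 (R : pzRingType) (M : lmodType R)
  (hM : self_progenerator M) (hG : gelfand M)
  (hc : compact [set: max_spec M]) :
  frame_isomorphic (Psi M) (SPm M).
Proof. by have [projM genM] := hM; exact: Psi_frame_isomorphic. Qed.
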